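(* Let $N\in\{2,3\}$, let $\Omega\subset\mathbb{R}^N$ be a bounded Lipschitz domain, let $g>0$, and let $\mathsf{m}:\mathbb{R}^{N\times N}\to\mathbb{R}^{N\times N}$ be given by $\mathsf{m}(E)=\max(0,|E|-g)\frac{E}{|E|}$ if $E\neq 0$ and $\mathsf{m}(0)=0$. Let $G:L^2(\Omega;\mathbb{R}^{N\times N})\to L^2(\Omega;\mathbb{R}^{N\times N})$ be the Nemytskii operator associated with $\mathsf{m}$, i.e. for $z\in L^2(\Omega;\mathbb{R}^{N\times N})$, $G(z)(x):=\mathsf{m}(z(x))$ for almost all $x\in\Omega$. Then $G$ is directionally differentiable from $L^2(\Omega;\mathbb{R}^{N\times N})$ to $L^2(\Omega;\mathbb{R}^{N\times N})$.
   Context: $|\cdot|$ is the Frobenius norm on $\mathbb{R}^{N\times N}$. Directional differentiability of $G$ means: for all $z,h\in L^2(\Omega;\mathbb{R}^{N\times N})$ there is $G'(z;h)\in L^2(\Omega;\mathbb{R}^{N\times N})$ such that $\left\|\frac{G(z+th)-G(z)}{t}-G'(z;h)\right\|_{L^2(\Omega;\mathbb{R}^{N\times N})}\to 0$ as $t\downarrow 0$. *)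

(* Defs.v *)
From HB Require Import structures.
From mathcomp Require Import all_boot all_order all_algebra.
From mathcomp Require Import all_classical all_reals all_analysis.
From mathcomp Require Import measurable_realfun.
From mathcomp Require Import ring lra.
Set Implicit Arguments.
Unset Strict Implicit.
Unset Printing Implicit Defensive.
Import Order.TTheory GRing.Theory Num.Theory.
Import numFieldNormedType.Exports.
Local Open Scope classical_set_scope.
Local Open Scope ring_scope.

(* R^n with its Borel sigma-algebra; convertible to 'rV[R]_n. *)
Notation borel_rV R n := (g_sigma_algebraType (@open 'rV[R]_n)).

Section borel_rV.
Context (R : realType) (n : nat).

Lemma measurable_coord_rV (j : 'I_n) :
  measurable_fun [set: borel_rV R n]
    (fun v : borel_rV R n => (v : 'rV[R]_n) 0 j).
Proof.
apply: (measurability _ (RGenOInfty.measurableE R)) => _ [_ [a ->] <-].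
rewrite setTI; apply: sub_sigma_algebra.
apply: (@open_comp 'rV[R]_n R (fun v => v 0 j)); last exact: interval_open.
by move=> v _; exact: coord_continuous.
Qed.

Let rat_ball (p : 'rV[rat]_n * nat) : set 'rV[R]_n :=
  ball (map_mx (ratr : rat -> R) p.1) p.2.+1%:R^-1.

Let open_rat_balls (U : set 'rV[R]_n) : open U ->
  U = \bigcup_(p in [set p | rat_ball p `<=` U]) rat_ball p.
Proof.
move=> oU; apply/seteqP; split => [v Uv|v [p /= pU pv]]; last exact: pU.
have /nbhs_ballP[e e0 eU] : nbhs v U by exact: open_nbhs_nbhs.
have e20 : 0 < e / 2 :> R by rewrite divr_gt0.
have [k _ kP] := near_infty_natSinv_lt (PosNum e20).
have {kP} ke := kP k (leqnn k).
have k0 : 0 < k.+1%:R^-1 :> R by rewrite invr_gt0.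
have /choice[q qP] (j : 'I_n) : exists q : rat, `|ratr q - v 0 j| < k.+1%:R^-1.
  have /rat_in_itvoo[q qv] : v 0 j - k.+1%:R^-1 < v 0 j + k.+1%:R^-1.
    by rewrite ltrBlDr -addrA ltrDl addr_gt0.
  by exists q; move: qv; rewrite in_itv/= ltr_distl.
exists (\row_j q j, k) => /=.
  move=> w [_ wq]; apply: eU; split => // i j; rewrite !ord1.
  have := wq 0 j; rewrite !mxE /ball/= => wqj.
  have -> : e = e / 2 + e / 2 by field.
  rewrite (le_lt_trans (ler_distD (ratr (q j)) _ _))// ltrD//.
    by rewrite distrC (lt_trans (qP j)).
  by rewrite (lt_trans wqj).
by split => // i j; rewrite !ord1 !mxE /ball/=; exact: qP.
Qed.

Lemma measurable_fun_rV d (T : measurableType d) (f : T -> borel_rV R n) :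
  (forall j, measurable_fun [set: T] (fun x => (f x : 'rV[R]_n) 0 j)) ->
  measurable_fun [set: T] f.
Proof.
move=> mf.
apply: (@measurability _ _ T (borel_rV R n) setT f (@open 'rV[R]_n) erefl).
move=> _ [U oU <-].
rewrite setTI (open_rat_balls oU) preimage_bigcup bigcup_mkcond.
apply: countable_bigcupT_measurable => [|p]; first exact: countableP.
case: ifPn => // _.
rewrite (_ : _ @^-1` _ =
    \bigcap_(j : 'I_n) ((fun x => (f x : 'rV[R]_n) 0 j) @^-1`
       ball (ratr (p.1 0 j) : R) p.2.+1%:R^-1)).
  apply: fin_bigcap_measurable => [|j _]; first exact: finite_finset.
  rewrite -[X in measurable X]setTI; apply: mf => //.
  exact: open_measurable (ball_open _ _).
apply/seteqP; split => x /=.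
  by move=> [_ fx] j _; have := fx 0 j; rewrite mxE.
move=> fx; split; first by rewrite invr_gt0.
by move=> i j; rewrite ord1 mxE; exact: fx.
Qed.

End borel_rV.

Section lebesgue_rV.
Context (R : realType).

Section step.
Variable n : nat.

Definition cons_rV (p : R * borel_rV R n) : borel_rV R n.+1 :=
  row_mx (p.1%:M : 'M[R]_1) p.2.

Lemma cons_rV0 p : (cons_rV p : 'rV[R]_n.+1) 0 0 = p.1.
Proof.
transitivity (row_mx (p.1%:M : 'M[R]_1) (p.2 : 'rV[R]_n) 0 (lshift n 0)).
  by congr (row_mx _ _ _ _); exact: val_inj.
by rewrite row_mxEl mxE eqxx mulr1n.
Qed.

Lemma cons_rVS p j :
  (cons_rV p : 'rV[R]_n.+1) 0 (lift ord0 j) = (p.2 : 'rV[R]_n) 0 j.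
Proof.
transitivity (row_mx (p.1%:M : 'M[R]_1) (p.2 : 'rV[R]_n) 0 (rshift 1 j)).
  by congr (row_mx _ _ _ _); exact: val_inj.
by rewrite row_mxEr.
Qed.

Lemma measurable_cons_rV : measurable_fun [set: R * borel_rV R n] cons_rV.
Proof.
apply: measurable_fun_rV => j; case: (unliftP ord0 j) => [k ->|->].
  under eq_fun do rewrite cons_rVS.
  exact: (measurableT_comp (measurable_coord_rV k) measurable_snd).
under eq_fun do rewrite cons_rV0.
exact: measurable_fst.
Qed.

Let uncons (v : borel_rV R n.+1) : R * borel_rV R n :=
  ((v : 'rV[R]_n.+1) 0 0, \row_j (v : 'rV[R]_n.+1) 0 (lift ord0 j)).

Let unconsK : cancel cons_rV uncons.
Proof.
move=> p; rewrite /uncons cons_rV0 [RHS]surjective_pairing; congr pair.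
by apply/rowP => j; rewrite mxE cons_rVS.
Qed.

Let measurable_uncons : measurable_fun [set: borel_rV R n.+1] uncons.
Proof.
apply: measurable_fun_pair; first exact: measurable_coord_rV.
apply: measurable_fun_rV => j; under eq_fun do rewrite mxE.
exact: measurable_coord_rV.
Qed.

Variable m : {sigma_finite_measure set (borel_rV R n) -> \bar R}.

(* The image on R^(n+1) of the product measure on R x R^n. *)
Definition cons_measure : set (borel_rV R n.+1) -> \bar R :=
  pushforward (lebesgue_measure \x m)%E cons_rV.

Let cons_measure0 : cons_measure set0 = 0%E.
Proof. by apply: measure0; exact: measurable_cons_rV. Qed.

Let cons_measure_ge0 A : (0 <= cons_measure A)%E.
Proof. by apply: measure_ge0; exact: measurable_cons_rV. Qed.

Let cons_measure_sigma_additive : semi_sigma_additive cons_measure.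
Proof. by apply: measure_semi_sigma_additive; exact: measurable_cons_rV. Qed.

HB.instance Definition _ := isMeasure.Build _ _ _ cons_measure
  cons_measure0 cons_measure_ge0 cons_measure_sigma_additive.

Let cons_measure_sigma_finite :
  sigma_finite [set: borel_rV R n.+1] cons_measure.
Proof.
have /sigma_finiteP[F [FT ndF Foo]] := sigma_finiteT (@lebesgue_measure R).
have /sigma_finiteP[G [GT ndG Goo]] := sigma_finiteT m.
exists (fun k => uncons @^-1` (F k `*` G k)) => [|k].
  rewrite -preimage_bigcup -[LHS](preimage_setT uncons); congr (_ @^-1` _).
  rewrite -setXTT FT GT; apply/seteqP; split => [[x y]|[x y]].
    move=> [/= [i _ Fx] [j _ Gy]]; exists (maxn i j) => //; split => /=.
      by move: x Fx; exact/subsetPset/ndF/leq_maxl.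
    by move: y Gy; exact/subsetPset/ndG/leq_maxr.
  by move=> [i _ [/= Fx Gy]]; split; exists i.
have [mF Fk] := Foo k; have [mG Gk] := Goo k.
have mFG : measurable (F k `*` G k) by exact: measurableX.
split; first by rewrite -[X in measurable X]setTI; exact: measurable_uncons.
rewrite /cons_measure /pushforward -comp_preimage.
rewrite (_ : uncons \o cons_rV = id); last exact/funext/unconsK.
by rewrite preimage_id product_measure1E// lte_mul_pinfty// ge0_fin_numE.
Qed.

HB.instance Definition _ := Measure_isSigmaFinite.Build _ _ _ cons_measure
  cons_measure_sigma_finite.

End step.

Fixpoint lebesgue_rV (n : nat) :
    {sigma_finite_measure set (borel_rV R n) -> \bar R} :=
  if n is k.+1 return {sigma_finite_measure set (borel_rV R n) -> \bar R}
  then cons_measure (lebesgue_rV k)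
  else @dirac _ (borel_rV R 0) (0 : 'rV[R]_0) R.

Lemma lebesgue_rV_box n (A : 'I_n -> set R) : (forall j, measurable (A j)) ->
  lebesgue_rV n [set v : 'rV[R]_n | forall j, A j (v 0 j)] =
  (\prod_(j < n) lebesgue_measure (A j))%E.
Proof.
elim: n A => [|n ih] A mA.
  by rewrite big_ord0 /= diracE mem_set//= => -[].
have mB : measurable ([set v | forall j, A (lift ord0 j) ((v : 'rV[R]_n) 0 j)] :
    set (borel_rV R n)).
  rewrite (_ : mkset _ = \bigcap_(j : 'I_n) ((fun v : borel_rV R n =>
      (v : 'rV[R]_n) 0 j) @^-1` A (lift ord0 j))).
    apply: fin_bigcap_measurable => [|j _]; first exact: finite_finset.
    by rewrite -[X in measurable X]setTI; exact: measurable_coord_rV.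
  by apply/seteqP; split => v /= vA j; [move=> _|]; exact: vA.
rewrite big_ord_recl -ih// -product_measure1E//; last exact: mA.
rewrite /= /cons_measure /pushforward; congr (product_measure1 _ _ _).
apply/seteqP; split => [p /= pA|p /= [pA0 pAS] j].
  split => [|j]; first by have := pA 0; rewrite cons_rV0.
  by have := pA (lift ord0 j); rewrite cons_rVS.
by case: (unliftP ord0 j) => [k ->|->]; rewrite (cons_rV0, cons_rVS).
Qed.

End lebesgue_rV.


Definition frobenius (R : realType) (n : nat) (E : 'M[R]_n) : R :=
  Num.sqrt (\sum_i \sum_j E i j ^+ 2).

Definition soft_threshold (R : realType) (n : nat) (g : R)
    (E : 'M[R]_n) : 'M[R]_n :=
  if E == 0 then 0
  else Num.max 0 (frobenius E - g) *: ((frobenius E)^-1 *: E).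

(* Near every boundary point, Omega is, after an orthogonal change of
   coordinates, the strict epigraph of a Lipschitz function of the coordinates
   other than the i-th. The norm on 'rV[R]_n.-1 is the sup norm, which makes no
   difference for being Lipschitz. *)
Definition lipschitz_boundary (R : realType) (n : nat) (Omega : set 'rV[R]_n) :=
  forall x, closure Omega x -> ~ Omega° x ->
  exists (O : 'M[R]_n) (i : 'I_n) (gamma : 'rV[R]_n.-1 -> R),
    [/\ O *m O^T = 1%:M, lipschitz gamma &
        \forall y \near x,
          Omega y <-> gamma (col' i (y *m O)) < (y *m O) 0 i].

Definition bounded_lipschitz_domain (R : realType) (n : nat)
    (Omega : set 'rV[R]_n) :=
  [/\ open Omega, connected Omega, Omega !=set0, bounded_set Omega &
      lipschitz_boundary Omega].

Section L2.
Context (R : realType) (n : nat).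
Local Notation X := (borel_rV R n).
Variable Omega : set X.
Local Notation lambda := (lebesgue_rV R n).

Definition L2norm_fun (f : X -> 'M[R]_n) : \bar R :=
  'N[lambda]_2%:E [EFin \o (@frobenius R n \o f) \_ Omega].

(* Functions on Omega are represented by functions on R^n whose values outside
   Omega are irrelevant. Measurability on Omega is stated for the extension by
   zero: for Omega Borel this is measurability on Omega, and it yields a vector
   space for arbitrary Omega. *)
Definition square_integrable : {pred X -> 'M[R]_n} := mem
 [set f : X -> 'M[R]_n |
  (forall i j, measurable_fun [set: X] ((fun x : X => f x i j) \_ Omega)) /\
  (L2norm_fun f < +oo)%E].

Let sqr_fun (f : X -> 'M[R]_n) (x : X) : R :=
  \sum_i \sum_j (((fun x : X => f x i j) \_ Omega) x) ^+ 2.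

Let sqr_fun_ge0 f x : 0 <= sqr_fun f x.
Proof. by do 2!apply: sumr_ge0 => ? _; exact: sqr_ge0. Qed.

Let measurable_sqr_fun (f : X -> 'M[R]_n) :
  (forall i j, measurable_fun [set: X] ((fun x : X => f x i j) \_ Omega)) ->
  measurable_fun [set: X] (sqr_fun f).
Proof.
move=> mf; apply: measurable_sum => i; apply: measurable_sum => j.
exact: measurable_funX.
Qed.

Let measurable_EFin_sqr_fun (f : X -> 'M[R]_n) :
  (forall i j, measurable_fun [set: X] ((fun x : X => f x i j) \_ Omega)) ->
  measurable_fun [set: X] (fun x => (sqr_fun f x)%:E).
Proof. by move=> mf; apply/measurable_EFinP; exact: measurable_sqr_fun. Qed.

Let restrict_frobenius (f : X -> 'M[R]_n) x :
  ((@frobenius R n \o f) \_ Omega) x = Num.sqrt (sqr_fun f x).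
Proof.
rewrite /sqr_fun patchE; case: ifPn => xO /=.
  congr Num.sqrt; apply: eq_bigr => i _; apply: eq_bigr => j _.
  by rewrite patchE xO.
rewrite big1 ?sqrtr0// => i _; rewrite big1// => j _.
by rewrite patchE (negbTE xO) expr0n.
Qed.

Lemma L2norm_funE f : L2norm_fun f =
  ((\int[lambda]_x (sqr_fun f x)%:E) `^ 2^-1)%E.
Proof.
rewrite /L2norm_fun unlock; congr (_ `^ _)%E; apply: eq_integral => x _ /=.
rewrite restrict_frobenius ger0_norm ?sqrtr_ge0//.
by rewrite powR_mulrn ?sqrtr_ge0// sqr_sqrtr.
Qed.

Let L2norm_fun_lty f :
  (L2norm_fun f < +oo)%E <-> (\int[lambda]_x (sqr_fun f x)%:E < +oo)%E.
Proof.
rewrite L2norm_funE; split => [|/poweR_lty]; last exact.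
by apply: lty_poweRy; rewrite invr_eq0.
Qed.

Let square_integrable_submod_closed : submod_closed square_integrable.
Proof.
split=> [|a f g].
  rewrite inE/=; split => [i j|].
    rewrite (_ : _ \_ _ = cst 0)//.
    by apply/funext => x; rewrite patchE mxE if_same.
  apply/L2norm_fun_lty; rewrite integral0_eq// => x _.
  rewrite /sqr_fun big1// => i _; rewrite big1// => j _.
  by rewrite patchE mxE if_same expr0n.
rewrite !inE/= => -[mf /L2norm_fun_lty foo] [mg /L2norm_fun_lty goo].
have afg i j : (fun x : X => (a *: f + g) x i j) \_ Omega =
    (fun x => a * ((fun x : X => f x i j) \_ Omega) x +
      ((fun x : X => g x i j) \_ Omega) x).
  apply/funext => x; rewrite !patchE.
  by case: ifPn => _; rewrite ?mxE// mulr0 addr0.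
have mafg i j : measurable_fun [set: X]
    ((fun x : X => (a *: f + g) x i j) \_ Omega).
  by rewrite afg; apply: measurable_funD => //; exact: measurable_funM.
split=> //; apply/L2norm_fun_lty.
have mEf : measurable_fun [set: X] (fun x => (sqr_fun f x)%:E).
  exact: measurable_EFin_sqr_fun.
have mEg : measurable_fun [set: X] (fun x => (sqr_fun g x)%:E).
  exact: measurable_EFin_sqr_fun.
apply: (@le_lt_trans _ _ (\int[lambda]_x
    ((2 * a ^+ 2)%:E * (sqr_fun f x)%:E + 2%:E * (sqr_fun g x)%:E))%E).
  apply: ge0_le_integral => //.
  - by move=> x _; rewrite lee_fin.
  - exact: measurable_EFin_sqr_fun.
  - by apply: emeasurable_funD; exact: emeasurable_funM.
  - move=> x _; rewrite -!EFinM -EFinD lee_fin /sqr_fun !mulr_sumr -big_split/=.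
    apply: ler_sum => i _; rewrite !mulr_sumr -big_split/=.
    apply: ler_sum => j _.
    rewrite afg; set u := (_ \_ _) x; set v := (_ \_ _) x.
    rewrite -subr_ge0 (_ : _ - _ = (a * u - v) ^+ 2) ?sqr_ge0//.
    by ring.
have a0 : 0 <= 2 * a ^+ 2 by rewrite mulr_ge0// sqr_ge0.
rewrite ge0_integralD//; last 4 first.
- by move=> x _; rewrite -EFinM lee_fin mulr_ge0.
- exact: emeasurable_funM.
- by move=> x _; rewrite -EFinM lee_fin mulr_ge0.
- exact: emeasurable_funM.
rewrite !ge0_integralZl//; try by move=> x _; rewrite lee_fin.
by rewrite lte_add_pinfty// lte_mul_pinfty// lee_fin.
Qed.

HB.instance Definition _ := GRing.isSubmodClosed.Build _ _ square_integrable
  square_integrable_submod_closed.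

Lemma square_integrable_soft_threshold g (f : X -> 'M[R]_n) : 0 <= g ->
  f \in square_integrable -> soft_threshold g \o f \in square_integrable.
Proof.
move=> g0; rewrite !inE/= => -[mf /L2norm_fun_lty foo].
pose c x := Num.max 0 (Num.sqrt (sqr_fun f x) - g) *
  (Num.sqrt (sqr_fun f x))^-1.
have mE i j : (fun x : X => (soft_threshold g (f x)) i j) \_ Omega =
    (fun x : X => c x * ((fun x : X => f x i j) \_ Omega) x).
  apply/funext => x; rewrite /c -restrict_frobenius !patchE.
  case: ifPn => _; rewrite ?mulr0//= /soft_threshold.
  by case: eqP => [->|_]; rewrite !mxE ?mulr0// mulrA.
have sqrtE x : Num.sqrt (sqr_fun f x) = sqr_fun f x `^ 2^-1
  by rewrite powR12_sqrt.
have mc : measurable_fun [set: X] c.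
  apply: measurable_funM.
    apply: measurable_maxr => //; apply: measurable_funB => //.
    under eq_fun do rewrite sqrtE.
    by apply: (measurableT_comp (measurable_powR _)); exact: measurable_sqr_fun.
  under eq_fun do rewrite sqrtE -powRN.
  by apply: (measurableT_comp (measurable_powR _)); exact: measurable_sqr_fun.
have mm i j : measurable_fun [set: X]
    ((fun x : X => (soft_threshold g (f x)) i j) \_ Omega).
  by rewrite mE; exact: measurable_funM.
split=> //; apply/L2norm_fun_lty; apply: le_lt_trans foo.
apply: ge0_le_integral => //.
- by move=> x _; rewrite lee_fin.
- exact: measurable_EFin_sqr_fun.
- exact: measurable_EFin_sqr_fun.
- move=> x _; rewrite lee_fin; apply: ler_sum => i _; apply: ler_sum => j _.
  rewrite mE exprMn ler_piMl ?sqr_ge0// exprn_ile1//.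
    by rewrite mulr_ge0 ?invr_ge0 ?sqrtr_ge0// le_max lexx.
  have := sqrtr_ge0 (sqr_fun f x); rewrite /c le_eqVlt => /predU1P[<-|s0].
    by rewrite invr0 mulr0.
  by rewrite ler_pdivrMr// mul1r ge_max ltW//= gerBl.
Qed.

Definition sqint_fun := {f : X -> 'M[R]_n | f \in square_integrable}.
HB.instance Definition _ := [isSub of sqint_fun for @proj1_sig _ _].
HB.instance Definition _ := [Choice of sqint_fun by <:].
HB.instance Definition _ := [SubChoice_isSubLmodule of sqint_fun by <:].

Definition ae_zero : {pred sqint_fun} :=
  [pred f | `[< {ae lambda, forall x : X, Omega x -> val f x = 0} >]].

Let ae_zero_submod_closed : submod_closed ae_zero.
Proof.
split=> [|a f g /asboolP f0 /asboolP g0]; apply/asboolP.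
  exact: aeW.
apply: filterS2 f0 g0 => x /= f0 g0 Ox.
by rewrite -[LHS]/(a *: sval f x + sval g x) f0// g0// scaler0 addr0.
Qed.

HB.instance Definition _ := GRing.isSubmodClosed.Build _ _ ae_zero
  ae_zero_submod_closed.

(* Square-integrable functions modulo equality almost everywhere in Omega. *)
Definition L2 := Quotient.quot ae_zero.
HB.instance Definition _ := Choice.on L2.
HB.instance Definition _ := GRing.Zmodule.on L2.
HB.instance Definition _ := EqQuotient.on L2.

Local Open Scope quotient_scope.

(* A representative of the class z. *)
Definition L2_fun (z : L2) : X -> 'M[R]_n := val (repr z).

Lemma pi_L2P (f g : sqint_fun) :
  reflect (\pi_L2 f = \pi_L2 g) (f - g \in ae_zero).
Proof. by rewrite Quotient.idealrBE; exact: eqP. Qed.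

Lemma pi_L2E (f : sqint_fun) :
  {ae lambda, forall x : X, Omega x -> L2_fun (\pi_L2 f) x = val f x}.
Proof.
have /pi_L2P/asboolP : \pi_L2 (repr (\pi_L2 f)) = \pi_L2 f by rewrite reprK.
apply: filterS => x f0 Ox; apply/eqP; rewrite -subr_eq0; apply/eqP.
exact: f0.
Qed.

Let L2_scale (a : R) : L2 -> L2 := lift_op1 L2 ( *:%R a).

Let pi_scale a : {morph \pi_L2 : f / a *: f >-> L2_scale a f}.
Proof.
move=> f; unlock L2_scale; apply/pi_L2P; rewrite -scalerBr rpredZ//.
by apply/pi_L2P; rewrite reprK.
Qed.

Let L2_scaleA a b z : L2_scale a (L2_scale b z) = L2_scale (a * b) z.
Proof. by rewrite -[z]reprK -!pi_scale scalerA. Qed.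

Let L2_scale1 : left_id 1 L2_scale.
Proof. by move=> z; rewrite -[z]reprK -!pi_scale scale1r. Qed.

Lemma pi_L2D : {morph \pi_L2 : f g / f + g}.
Proof. exact: Quotient.pi_add. Qed.

Let L2_scaleDr : right_distributive L2_scale +%R.
Proof.
move=> a y z; rewrite -[y]reprK -[z]reprK.
by rewrite -pi_L2D -!pi_scale -pi_L2D scalerDr.
Qed.

Let L2_scaleDl z : {morph L2_scale^~ z : a b / a + b}.
Proof. by move=> a b; rewrite -[z]reprK -!pi_scale -pi_L2D scalerDl. Qed.

HB.instance Definition _ := GRing.Zmodule_isLmodule.Build R L2
  L2_scaleA L2_scale1 L2_scaleDr L2_scaleDl.

Lemma pi_L2Z a : {morph \pi_L2 : f / a *: f}.
Proof. exact: pi_scale. Qed.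

Definition L2norm (z : L2) : \bar R := L2norm_fun (L2_fun z).

Lemma L2norm_piE (f : sqint_fun) : L2norm (\pi_L2 f) = L2norm_fun (val f).
Proof.
rewrite /L2norm !L2norm_funE; congr (_ `^ _)%E.
have mL (h : sqint_fun) : measurable_fun [set: X]
    (fun x => (sqr_fun (val h) x)%:E).
  apply: measurable_EFin_sqr_fun => i j.
  by have := valP h; rewrite inE => -[mh _]; exact: mh.
apply: ge0_ae_eq_integral => //; try exact: mL.
- by move=> x _; rewrite lee_fin.
- by move=> x _; rewrite lee_fin.
apply: filterS (pi_L2E f) => x fE _; congr EFin.
apply: eq_bigr => i _; apply: eq_bigr => j _; rewrite !patchE.
by case: ifPn => // /set_mem Ox; rewrite fE.
Qed.

End L2.

Coercion L2_fun : L2 >-> Funclass.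

Definition is_nemytskii (R : realType) (n : nat) (Omega : set (borel_rV R n))
    (phi : 'M[R]_n -> 'M[R]_n) (G : L2 Omega -> L2 Omega) :=
  forall z : L2 Omega,
    {ae lebesgue_rV R n, forall x, Omega x -> G z x = phi (z x)}.

Lemma soft_threshold_nemytskii (R : realType) (n : nat)
    (Omega : set (borel_rV R n)) (g : R) : 0 <= g ->
  exists G : L2 Omega -> L2 Omega, is_nemytskii (soft_threshold g) G.
Proof.
move=> g0.
have /choice[G GP] (z : L2 Omega) : exists w : L2 Omega,
    {ae lebesgue_rV R n, forall x, Omega x -> w x = soft_threshold g (z x)}.
  pose f : sqint_fun Omega :=
    exist (fun f => f \in square_integrable Omega) _
      (square_integrable_soft_threshold g0 (valP (repr z))).
  exists (\pi_(L2 Omega)%qT f); exact: pi_L2E.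
by exists G.
Qed.

Definition directionally_differentiable (R : realType) (n : nat)
    (Omega : set (borel_rV R n)) (G : L2 Omega -> L2 Omega) :=
  forall z h : L2 Omega, exists dG : L2 Omega,
    L2norm (t^-1 *: (G (z + t *: h) - G z) - dG) @[t --> 0^'+] --> 0%E.

(* Main.v *)
(* Write m(E) = p(|E|) E with p(r) = max(0, 1 - g/r). The map m is Lipschitz and
   has one-sided directional derivatives m'(E; H): the norm is differentiable
   away from the origin, and m vanishes near the origin. The difference quotients
   of G in direction h thus converge pointwise to m'(z(x); h(x)), and they are
   dominated by a multiple of |h(x)|, so they converge in L^2 by dominated
   convergence. *)
Require Import Defs.
From mathcomp Require Import all_boot all_order all_algebra.
From mathcomp Require Import all_classical all_reals all_analysis.
From mathcomp Require Import measurable_realfun ring lra.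
Import Order.TTheory GRing.Theory Num.Theory.
Import numFieldNormedType.Exports.
Local Open Scope classical_set_scope.
Local Open Scope ring_scope.

(** * Matrix estimates: the Frobenius norm and the soft threshold *)

Section pointwise.
Context {R : realType} {n : nat}.
Implicit Types (E F H : 'M[R]_n) (g r s t : R).

Lemma frobenius_sqr E : frobenius E ^+ 2 = \sum_i \sum_j E i j ^+ 2.
Proof.
by rewrite sqr_sqrtr//; do 2!apply: sumr_ge0 => ? _; exact: sqr_ge0.
Qed.

Lemma frobenius_ge0 E : 0 <= frobenius E.
Proof. exact: sqrtr_ge0. Qed.

Lemma norm_le_frobenius E i j : `|E i j| <= frobenius E.
Proof.
rewrite -(@ler_pXn2r _ 2)// ?nnegrE ?frobenius_ge0//.
rewrite frobenius_sqr real_normK ?num_real//.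
rewrite (bigD1 i)//= (bigD1 j)//= -addrA lerDl addr_ge0//.
  by apply: sumr_ge0 => ? _; exact: sqr_ge0.
by do 2!apply: sumr_ge0 => ? _; exact: sqr_ge0.
Qed.

Lemma frobenius_eq0 E : frobenius E = 0 -> E = 0.
Proof.
move=> E0; apply/matrixP => i j; rewrite mxE; apply/eqP.
by rewrite -normr_le0 -E0 norm_le_frobenius.
Qed.

(* A crude reverse triangle inequality, avoiding Cauchy-Schwarz: each summand of
   |E|^2 - |F|^2 factors as (E_ij - F_ij)(E_ij + F_ij), with
   |E_ij + F_ij| <= |E| + |F|. *)
Lemma frobenius_dist E F :
  `|frobenius E - frobenius F| <= (n * n)%:R * frobenius (E - F).
Proof.
have := frobenius_ge0 E; have := frobenius_ge0 F.
set r := frobenius E; set s := frobenius F => s0 r0.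
have := addr_ge0 r0 s0; rewrite le_eqVlt => /predU1P[|rs0].
  move=> /esym/eqP; rewrite paddr_eq0// => /andP[/eqP -> /eqP ->].
  by rewrite subrr normr0 mulr_ge0// frobenius_ge0.
rewrite -(ler_pM2r rs0) -{1}(gtr0_norm rs0) -normrM -subr_sqr !frobenius_sqr.
have nE c : n%:R * c = \sum_(i < n) c by rewrite sumr_const card_ord mulr_natl.
rewrite -sumrB natrM -!mulrA !nE.
apply: le_trans (ler_norm_sum _ _ _) _; apply: ler_sum => i _.
rewrite -sumrB.
apply: le_trans (ler_norm_sum _ _ _) _; apply: ler_sum => j _.
rewrite subr_sqr normrM ler_pM//.
  by have := norm_le_frobenius (E - F) i j; rewrite !mxE.
by rewrite (le_trans (ler_normD _ _))// lerD// norm_le_frobenius.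
Qed.

Lemma frobeniusZ t E : frobenius (t *: E) = `|t| * frobenius E.
Proof.
rewrite -sqrtr_sqr -sqrtrM ?sqr_ge0//; congr Num.sqrt.
rewrite mulr_sumr; apply: eq_bigr => i _.
by rewrite mulr_sumr; apply: eq_bigr => j _; rewrite mxE exprMn.
Qed.

(** One formula for both cases: at [E = 0] the convention that the inverse of 0 is 0 gives the
    factor 1, which then multiplies the zero matrix. *)
Lemma soft_thresholdE g E : 0 <= g ->
  soft_threshold g E = Num.max 0 (1 - g / frobenius E) *: E.
Proof.
rewrite /soft_threshold => g0; case: eqP => [->|E0]; first by rewrite scaler0.
have r0 : 0 < frobenius E.
  by rewrite lt_def frobenius_ge0 andbT; apply/eqP => /frobenius_eq0.
by rewrite scalerA maxr_pMl ?invr_ge0 ?ltW// mul0r mulrBl divff// gt_eqF.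
Qed.

Lemma soft_threshold_eq0 g E : frobenius E <= g -> soft_threshold g E = 0.
Proof.
rewrite /soft_threshold => Eg; case: eqP => // _.
by rewrite max_l ?scale0r// subr_le0.
Qed.

(** With scalar factors [p] of [E] and [q] of [F], write [p E - q F = p (E - F) + (p - q) F]. The
    first term is controlled by [p <= 1], the second by [|p - q| |F| <= |E| - |F|] when
    [|F| <= |E|]; [frobenius_dist] contributes the [n * n] in the constant. *)
Lemma soft_threshold_lipschitz g E F i j : 0 <= g ->
  `|soft_threshold g E i j - soft_threshold g F i j| <=
  (1 + (n * n)%:R) * frobenius (E - F).
Proof.
move=> g0; wlog FE : E F / frobenius F <= frobenius E => [wlg|].
  case: (leP (frobenius F) (frobenius E)) => [|/ltW]; first exact: wlg.
  move=> /wlg; rewrite distrC => /le_trans; apply.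
  by rewrite -opprB -scaleN1r frobeniusZ normrN1 mul1r.
rewrite !soft_thresholdE// !mxE.
set p := Num.max _ _; set q := Num.max _ _.
have q0 : 0 <= q by rewrite le_max lexx.
have p0 : 0 <= p by rewrite le_max lexx.
have p1 : p <= 1 by rewrite ge_max ler01 gerBl divr_ge0// frobenius_ge0.
have pq : `|p - q| * frobenius F <= frobenius E - frobenius F.
  move: (frobenius_ge0 F); rewrite le_eqVlt => /predU1P[<-|s0].
    by rewrite mulr0 subr0 frobenius_ge0.
  have r0 := lt_le_trans s0 FE.
  have rs : g / frobenius E <= g / frobenius F by rewrite ler_wpM2l// lef_pV2.
  have gE : g / frobenius E * frobenius E = g by rewrite divfK// gt_eqF.
  have gF : g / frobenius F * frobenius F = g by rewrite divfK// gt_eqF.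
  (* From [u |E| = g = v |F|] follows [(v - u) |F| = u (|E| - |F|)], which is at most [|E| - |F|] if
     [u <= 1]. The cases below are those of the two maxima. *)
  rewrite /p /q; move: rs gE gF; set u := g / _; set v := g / _ => uv uE vF.
  have u0 : 0 <= u by rewrite divr_ge0// ltW.
  rewrite ger0_norm; last first.
    by rewrite subr_ge0 ge_max !le_max lexx/= lerD2l lerN2 uv orbT.
  rewrite /Num.max; case: ltP => h1; case: ltP => h2; nra.
have -> : p * E i j - q * F i j = p * (E i j - F i j) + (p - q) * F i j by ring.
rewrite [leRHS]mulrDl mul1r (le_trans (ler_normD _ _))// lerD//.
  rewrite normrM ger0_norm// (le_trans (ler_piMl _ p1))//.
  by have := norm_le_frobenius (E - F) i j; rewrite !mxE.
apply: le_trans (frobenius_dist E F); rewrite normrM.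
apply: le_trans (le_trans pq (ler_norm _)).
by rewrite ler_wpM2l// norm_le_frobenius.
Qed.

(** * One-sided limits and derivatives along rays *)

Lemma frobenius_cvg E H : frobenius (E + t *: H) @[t --> 0^'+] --> frobenius E.
Proof.
apply/cvgrPdist_le => e e0.
(* The summand 1 keeps the divisor of [e] positive when [H = 0]. *)
have c0 : 0 < (n * n)%:R * frobenius H + 1.
  by rewrite ltr_wpDl// mulr_ge0// frobenius_ge0.
near=> t.
have t0 : 0 < t by near: t; exact: nbhs_right_gt.
rewrite distrC (le_trans (frobenius_dist _ _))//.
rewrite (_ : E + t *: H - E = t *: H); last by rewrite addrC addKr.
rewrite frobeniusZ gtr0_norm//.
have : t <= e / ((n * n)%:R * frobenius H + 1).
  by near: t; apply: nbhs_right_le; rewrite divr_gt0.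
rewrite ler_pdivlMr// => te.
have := frobenius_ge0 H.
nra.
Unshelve. all: by end_near. Qed.

(** Rationalize the quotient: [|E + t H|^2 - |E|^2 = t (b + t |H|^2)], where [b] is twice the inner
    product of [E] and [H], and the sum of the two norms stays away from 0. *)
Lemma frobenius_derivable E H : 0 < frobenius E ->
  cvg (t^-1 * (frobenius (E + t *: H) - frobenius E) @[t --> 0^'+]).
Proof.
move=> E0; pose b := \sum_i \sum_j 2 * (E i j * H i j).
(* The term with factor 0 is kept so that the limit has the shape of the quotient with [t] replaced
   by 0. *)
apply/cvg_ex; exists ((b + 0 * frobenius H ^+ 2) / (frobenius E + frobenius E)).
have : (b + t * frobenius H ^+ 2) / (frobenius (E + t *: H) + frobenius E)
    @[t --> 0^'+] --> (b + 0 * frobenius H ^+ 2) / (frobenius E + frobenius E).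
  apply: cvgM.
    apply: cvgD; [exact: cvg_cst|apply: cvgM; last exact: cvg_cst].
    exact: cvg_at_right_filter.
  apply: cvgV; first by rewrite gt_eqF// addr_gt0.
  by apply: cvgD; [exact: frobenius_cvg|exact: cvg_cst].
apply: cvg_trans; apply: near_eq_cvg; near=> t.
have t0 : 0 < t by near: t; exact: nbhs_right_gt.
have s0 : 0 < frobenius (E + t *: H) + frobenius E.
  by rewrite ltr_wpDl// frobenius_ge0.
apply/(mulIf (lt0r_neq0 s0)); rewrite divfK ?gt_eqF//.
rewrite -mulrA -subr_sqr; apply/(mulfI (lt0r_neq0 t0)).
rewrite mulVKf ?gt_eqF// !frobenius_sqr mulrDr mulrA -expr2 !mulr_sumr.
rewrite -sumrB -big_split/=; apply: eq_bigr => i _.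
rewrite !mulr_sumr -sumrB -big_split/=; apply: eq_bigr => j _.
by rewrite !mxE; ring.
Unshelve. all: by end_near. Qed.

Lemma soft_threshold_derivable g E H i j : 0 < g ->
  cvg (t^-1 * (soft_threshold g (E + t *: H) i j - soft_threshold g E i j)
    @[t --> 0^'+]).
Proof.
(* If [|E| < g], the norm stays below [g] for small [t] and the quotient vanishes. Otherwise [E] is
   nonzero and the scalar factor [max(0, v t)] is differentiated first. *)
move=> g0; have [Eg|gE] := ltP (frobenius E) g.
  apply/cvg_ex; exists 0; apply: cvg_near_cst.
  have := frobenius_cvg E H => /cvgrPdist_lt/(_ (g - frobenius E)).
  rewrite subr_gt0 => /(_ Eg); apply: filterS => t.
  rewrite distrC ltr_norml => /andP[_ tg].
  rewrite !soft_threshold_eq0 ?(ltW Eg) ?mxE ?subrr ?mulr0//.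
  by lra.
have E0 := lt_le_trans g0 gE.
have rE := frobenius_cvg E H.
have /cvg_ex[r' dr] := frobenius_derivable E H E0.
pose v t := 1 - g / frobenius (E + t *: H).
pose v0 := 1 - g / frobenius E.
have v00 : 0 <= v0 by rewrite subr_ge0 ler_pdivrMr// mul1r.
have vv0 : v t @[t --> 0^'+] --> v0.
  apply: cvgB; first exact: cvg_cst.
  by apply: cvgM; [exact: cvg_cst|apply: cvgV => //; rewrite gt_eqF].
pose v' := g * r' / (frobenius E * frobenius E).
have dv : t^-1 * (v t - v0) @[t --> 0^'+] --> v'.
  have : g * (t^-1 * (frobenius (E + t *: H) - frobenius E)) /
      (frobenius (E + t *: H) * frobenius E) @[t --> 0^'+] --> v'.
    apply: cvgM; first by apply: cvgM => //; exact: cvg_cst.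
    apply: cvgV; first by rewrite gt_eqF// mulr_gt0.
    by apply: cvgM => //; exact: cvg_cst.
  apply: cvg_trans; apply: near_eq_cvg; near=> t.
  have s0 : 0 < frobenius (E + t *: H).
    by near: t; exact: (cvgr_gt _ rE).
  have t0 : 0 < t by near: t; exact: nbhs_right_gt.
  by rewrite /v /v0; field; rewrite !gt_eqF.
have [p' dp] : exists p' : R,
    t^-1 * (Num.max 0 (v t) - Num.max 0 v0) @[t --> 0^'+] --> p'.
  (* On the kink [v0 = 0], positive homogeneity moves [1/t] inside the maximum, so the derivative is
     [max(0, v')]. If [v0 > 0], the maximum is inactive for small [t]. *)
  move: v00; rewrite le_eqVlt => /predU1P[v00|v0gt].
    exists (Num.max 0 v').
    have : Num.max 0 (t^-1 * (v t - v0)) @[t --> 0^'+] --> Num.max 0 v'.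
      under eq_fun do rewrite maxr_absE; rewrite maxr_absE.
      apply: cvgM; last exact: cvg_cst.
      apply: cvgD; first by apply: cvgD => //; exact: cvg_cst.
      by apply: cvg_norm; apply: cvgB => //; exact: cvg_cst.
    apply: cvg_trans; apply: near_eq_cvg; near=> t.
    have t0 : 0 < t by near: t; exact: nbhs_right_gt.
    by rewrite -v00 maxxx !subr0 maxr_pMr ?invr_ge0 ?ltW// mulr0.
  exists v'; apply: cvg_trans dv; apply: near_eq_cvg; near=> t.
  have vt : 0 < v t by near: t; exact: (cvgr_gt _ vv0).
  by rewrite !max_r// ltW.
have maxv : Num.max 0 (v t) @[t --> 0^'+] --> Num.max 0 v0.
  under eq_fun do rewrite maxr_absE; rewrite maxr_absE.
  apply: cvgM; last exact: cvg_cst.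
  apply: cvgD; first by apply: cvgD => //; exact: cvg_cst.
  by apply: cvg_norm; apply: cvgB => //; exact: cvg_cst.
(* Product rule for the scalar factor times [E + t H]. *)
apply/cvg_ex; exists (p' * E i j + Num.max 0 v0 * H i j).
have : t^-1 * (Num.max 0 (v t) - Num.max 0 v0) * E i j
    + Num.max 0 (v t) * H i j @[t --> 0^'+] -->
    p' * E i j + Num.max 0 v0 * H i j.
  by apply: cvgD; apply: cvgM => //; exact: cvg_cst.
apply: cvg_trans; apply: near_eq_cvg; near=> t.
have t0 : 0 < t by near: t; exact: nbhs_right_gt.
rewrite !(soft_thresholdE g _ (ltW g0)) !mxE -/(v t) -/v0.
by field; rewrite gt_eqF.
Unshelve. all: by end_near. Qed.

End pointwise.

(** * Domination and dominated convergence in the L2 norm *)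

Section L2norm.
Context {R : realType} {n : nat} {Omega : set (borel_rV R n)}.
Local Notation X := (borel_rV R n).
Local Notation lambda := (lebesgue_rV R n).
Implicit Types f h : X -> 'M[R]_n.

(** Extension by zero lets every integral run over the whole space. *)
Definition sqr_norm_fun f : X -> R := (fun x => frobenius (f x) ^+ 2) \_ Omega.

Lemma sqr_norm_fun_ge0 f x : 0 <= sqr_norm_fun f x.
Proof. by rewrite /sqr_norm_fun patchE; case: ifPn => // _; exact: sqr_ge0. Qed.

Lemma sqr_norm_funE f x : sqr_norm_fun f x =
  \sum_i \sum_j (((fun x : X => f x i j) \_ Omega) x) ^+ 2.
Proof.
rewrite /sqr_norm_fun patchE; case: ifPn => xO.
  rewrite frobenius_sqr; apply: eq_bigr => i _; apply: eq_bigr => j _.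
  by rewrite patchE xO.
rewrite big1// => i _; rewrite big1// => j _.
by rewrite patchE (negbTE xO) expr0n.
Qed.

Lemma L2norm_fun_sqr_norm f :
  L2norm_fun Omega f = ((\int[lambda]_x (sqr_norm_fun f x)%:E) `^ 2^-1)%E.
Proof.
rewrite L2norm_funE; congr (_ `^ _)%E.
by apply: eq_integral => x _; rewrite sqr_norm_funE.
Qed.

Lemma measurable_sqr_norm_fun f :
  (forall i j, measurable_fun [set: X] ((fun x : X => f x i j) \_ Omega)) ->
  measurable_fun [set: X] (EFin \o sqr_norm_fun f).
Proof.
move=> mf; apply/measurable_EFinP; rewrite (funext (sqr_norm_funE f)).
apply: measurable_sum => i; apply: measurable_sum => j.
exact: measurable_funX.
Qed.

(** The power 1/2 is finite exactly when its base is; integrability is the form that dominated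
    convergence uses. *)
Lemma square_integrableP f : f \in square_integrable Omega <->
  (forall i j, measurable_fun [set: X] ((fun x : X => f x i j) \_ Omega)) /\
  lambda.-integrable [set: X] (EFin \o sqr_norm_fun f).
Proof.
rewrite inE/= L2norm_fun_sqr_norm; split=> -[mf foo]; split=> //.
  apply/integrableP; split; first exact: measurable_sqr_norm_fun.
  under eq_integral do rewrite gee0_abs ?lee_fin ?sqr_norm_fun_ge0//.
  by move: foo; apply: lty_poweRy; rewrite invr_eq0.
apply: poweR_lty; move/integrableP: foo => [_].
by under eq_integral do rewrite gee0_abs ?lee_fin ?sqr_norm_fun_ge0//.
Qed.

Lemma sqr_norm_fun_le f h c x :
  (forall i j, `|f x i j| <= c * frobenius (h x)) ->
  sqr_norm_fun f x <= (n * n)%:R * c ^+ 2 * sqr_norm_fun h x.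
Proof.
move=> fh; rewrite /sqr_norm_fun !patchE.
case: ifPn => _; last by rewrite mulr0.
have nE b : n%:R * b = \sum_(i < n) b by rewrite sumr_const card_ord mulr_natl.
rewrite frobenius_sqr -mulrA -exprMn natrM -[leRHS]mulrA !nE.
apply: ler_sum => i _; apply: ler_sum => j _.
rewrite -real_normK ?num_real// ler_pXn2r// nnegrE//.
(* The remaining goal is [0 <= c * frobenius (h x)], which holds because [fh] bounds an absolute
   value by it. *)
exact: le_trans (fh i j).
Qed.

Lemma square_integrable_le f h c :
  (forall i j, measurable_fun [set: X] ((fun x : X => f x i j) \_ Omega)) ->
  (forall x i j, `|f x i j| <= c * frobenius (h x)) ->
  h \in square_integrable Omega -> f \in square_integrable Omega.
Proof.
move=> mf fh /square_integrableP[_ hoo]; apply/square_integrableP; split=> //.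
apply: (@le_integrable _ _ _ lambda _ _ _
  (fun x => ((n * n)%:R * c ^+ 2)%:E * (EFin \o sqr_norm_fun h) x)%E) => //.
- exact: measurable_sqr_norm_fun.
- move=> x _ /=; rewrite lee_fin (ger0_norm (sqr_norm_fun_ge0 _ _)).
  by apply: le_trans (ler_norm _); exact: sqr_norm_fun_le.
- exact: integrableZl.
Qed.

(** Dominated convergence for the squared norms, with an integrable multiple of [|h|^2] as
    dominating function, followed by continuity of the square root at 0. *)
Lemma L2norm_fun_cvg0 (f_ : R -> X -> 'M[R]_n) h c :
  (forall t, 0 < t -> f_ t \in square_integrable Omega) ->
  h \in square_integrable Omega ->
  (forall t x i j, 0 < t -> `|f_ t x i j| <= c * frobenius (h x)) ->
  (forall x i j, f_ t x i j @[t --> 0^'+] --> 0) ->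
  L2norm_fun Omega (f_ t) @[t --> 0^'+] --> 0%E.
Proof.
move=> f_int /square_integrableP[_ h_int] f_le f_cvg.
pose I t := (\int[lambda]_x (sqr_norm_fun (f_ t) x)%:E)%E.
have I0 : fine (I t) @[t --> 0^'+] --> 0.
  (* Dominated convergence is about sequences, so the one-sided limit is tested along positive
     sequences tending to 0. *)
  apply/cvg_at_rightP => u [u0 uto0]; apply: fine_cvg.
  rewrite -[X in _ --> X](integral0 lambda [set: X]).
  apply: (@dominated_cvg _ _ _ lambda _ measurableT
    (fun k => EFin \o sqr_norm_fun (f_ (u k))) (cst 0%E)
    (fun x => ((n * n)%:R * c ^+ 2)%:E * (EFin \o sqr_norm_fun h) x)%E) => //.
  - move=> k; apply: measurable_sqr_norm_fun.
    by have /square_integrableP[] := f_int _ (u0 k).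
  - move=> x _; apply: cvg_EFin; first by apply: nearW.
    rewrite (_ : 0 = \sum_(i < n) \sum_(j < n) 0 :> R); last first.
      by rewrite big1// => i _; rewrite big1.
    rewrite (_ : fine \o _ = fun k => \sum_i \sum_j
      (((fun x : X => f_ (u k) x i j) \_ Omega) x) ^+ 2); last first.
      by apply/funext => k; rewrite /= sqr_norm_funE.
    apply: (cvg_big (@add_continuous R^o)) => i _.
    apply: (cvg_big (@add_continuous R^o)) => j _.
    have [xO|xO] := boolP (x \in Omega); last first.
      under eq_fun do rewrite patchE (negbTE xO) expr0n; exact: cvg_cst.
    under eq_fun do rewrite patchE xO.
    have /cvg_at_rightP/(_ u (conj u0 uto0)) fij := f_cvg x i j.
    by have := cvg_comp _ _ fij (@exprn_continuous R 2 0); rewrite expr0n.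
  - exact: integrableZl.
  - move=> k x _ /=; rewrite lee_fin (ger0_norm (sqr_norm_fun_ge0 _ _)).
    by apply: sqr_norm_fun_le => i j; exact: f_le.
(* Integrability makes [I t] finite, so the extended power 1/2 is a real square root. *)
have IE t : 0 < t -> L2norm_fun Omega (f_ t) = (Num.sqrt (fine (I t)))%:E.
  move=> t0; rewrite L2norm_fun_sqr_norm -/(I t).
  have /square_integrableP[_ /integrable_fin_num] := f_int _ t0.
  move=> /(_ measurableT); rewrite -/(I t) => /fineK <-.
  rewrite poweR_EFin powR12_sqrt//.
  apply: fine_ge0; apply: integral_ge0 => x _.
  by rewrite lee_fin sqr_norm_fun_ge0.
have : (Num.sqrt (fine (I t)))%:E @[t --> 0^'+] --> 0%E.
  apply: cvg_EFin; first by apply: nearW.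
  by have := cvg_comp _ _ I0 (@sqrt_continuous R 0); rewrite sqrtr0.
apply: cvg_trans; apply: near_eq_cvg; near=> t.
by rewrite IE.
Unshelve. all: by end_near. Qed.

End L2norm.

(** * Nemytskii operators of Lipschitz, directionally differentiable maps *)

Section nemytskii.
Context {R : realType} {n : nat} {Omega : set (borel_rV R n)}.
Local Notation X := (borel_rV R n).
Variables (phi : 'M[R]_n -> 'M[R]_n) (c : R).
Hypothesis phi_square_integrable : forall f : X -> 'M[R]_n,
  f \in square_integrable Omega -> phi \o f \in square_integrable Omega.
Hypothesis phi_lipschitz : forall E F i j,
  `|phi E i j - phi F i j| <= c * frobenius (E - F).
Hypothesis phi_derivable : forall E H i j,
  cvg (t^-1 * (phi (E + t *: H) i j - phi E i j) @[t --> 0^'+]).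

Let diff_quotient t (E H : 'M[R]_n) := t^-1 *: (phi (E + t *: H) - phi E).

Let diff_quotient_le t E H i j : 0 < t ->
  `|diff_quotient t E H i j| <= c * frobenius H.
Proof.
move=> t0; rewrite !mxE normrM gtr0_norm ?invr_gt0// mulrC ler_pdivrMr//.
rewrite (le_trans (phi_lipschitz _ _ _ _))// -mulrA.
rewrite (_ : E + t *: H - E = t *: H); last by rewrite addrC addKr.
by rewrite frobeniusZ gtr0_norm// [t * _]mulrC.
Qed.

Let derivative (E H : 'M[R]_n) : 'M[R]_n :=
  \matrix_(i, j) lim (diff_quotient t E H i j @[t --> 0^'+]).

Let derivativeP E H i j :
  diff_quotient t E H i j @[t --> 0^'+] --> derivative E H i j.
Proof.
rewrite mxE (_ : (fun t => diff_quotient t E H i j) = fun t =>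
  t^-1 * (phi (E + t *: H) i j - phi E i j)); first exact: phi_derivable.
by apply/funext => t; rewrite !mxE.
Qed.

Let derivative_le E H i j : `|derivative E H i j| <= c * frobenius H.
Proof.
have /(@cvg_norm _ _ _ _ _) := derivativeP E H i j => dE.
rewrite -(cvg_lim _ dE)//; apply: limr_le.
  by apply/cvg_ex; eexists; exact: dE.
by near=> t; apply: diff_quotient_le.
Unshelve. all: by end_near. Qed.

Let diff_quotient_square_integrable t (z h : X -> 'M[R]_n) :
  z \in square_integrable Omega -> h \in square_integrable Omega ->
  (fun x => diff_quotient t (z x) (h x)) \in square_integrable Omega.
Proof.
move=> zS hS.
exact: (rpredZ _ (rpredB (phi_square_integrable _ (rpredD zS (rpredZ t hS)))
  (phi_square_integrable _ zS))).
Qed.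

(** Measurability comes from pointwise convergence of the difference quotients along [t = 1/(k+1)],
    and finiteness of the norm from [derivative_le]. *)
Let derivative_square_integrable (z h : X -> 'M[R]_n) :
  z \in square_integrable Omega -> h \in square_integrable Omega ->
  (fun x => derivative (z x) (h x)) \in square_integrable Omega.
Proof.
move=> zS hS; apply: (square_integrable_le _ h c) => // i j.
apply: (@measurable_fun_cvg _ _ _ _ (fun k =>
  (fun x : X => diff_quotient k.+1%:R^-1 (z x) (h x) i j) \_ Omega)) => [k|x _].
  have := diff_quotient_square_integrable k.+1%:R^-1 _ _ zS hS.
  by move=> /square_integrableP[].
rewrite patchE; have [xO|xO] := boolP (x \in Omega); last first.
  by under eq_fun do rewrite patchE (negbTE xO); exact: cvg_cst.
under eq_fun do rewrite patchE xO.
have := derivativeP (z x) (h x) i j => /cvg_at_rightP; apply; split.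
  by move=> k; rewrite invr_gt0.
exact: cvg_harmonic.
Qed.

(** The norm of the error is rewritten with representatives of [z] and [h], after which
    [L2norm_fun_cvg0] applies. *)
Lemma nemytskii_directionally_differentiable (G : L2 Omega -> L2 Omega) :
  is_nemytskii phi G -> directionally_differentiable G.
Proof.
move=> GP z h.
pose phi_comp (f : sqint_fun Omega) : sqint_fun Omega :=
  exist (fun f => f \in square_integrable Omega) _
    (phi_square_integrable _ (valP f)).
(* Both sides agree almost everywhere in [Omega]: the chosen representative of the class of [f]
   equals [f] there, and [G] acts on it through [phi]. *)
have GE (f : sqint_fun Omega) :
    G (\pi_(L2 Omega)%qT f) = \pi_(L2 Omega)%qT (phi_comp f).
  rewrite -[LHS]reprK; apply/pi_L2P/asboolP.
  apply: filterS2 (GP (\pi_(L2 Omega)%qT f)) (pi_L2E f) => x Gf fE Ox.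
  apply/eqP; rewrite subr_eq0; apply/eqP.
  by rewrite [LHS]Gf// fE.
pose dG : sqint_fun Omega :=
  exist (fun f => f \in square_integrable Omega) _
    (derivative_square_integrable _ _ (valP (repr z)) (valP (repr h))).
exists (\pi_(L2 Omega)%qT dG).
have piN (f : sqint_fun Omega) :
    - \pi_(L2 Omega)%qT f = \pi_(L2 Omega)%qT (- f).
  by rewrite -[in RHS]scaleN1r pi_L2Z scaleN1r.
have normE t : L2norm (t^-1 *: (G (z + t *: h) - G z) - \pi_(L2 Omega)%qT dG) =
    L2norm_fun Omega (fun x =>
      diff_quotient t (z x) (h x) - derivative (z x) (h x)).
  rewrite -[in LHS](reprK z) -[in LHS](reprK h) -pi_L2Z -pi_L2D !GE.
  by rewrite !piN -pi_L2D -pi_L2Z -pi_L2D L2norm_piE.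
under eq_fun do rewrite normE.
(* One [c] bounds the difference quotient, the other its limit. *)
apply: (L2norm_fun_cvg0 _ (L2_fun h) (c + c)).
- move=> t t0; apply: rpredB.
    exact: diff_quotient_square_integrable (valP (repr z)) (valP (repr h)).
  exact: derivative_square_integrable (valP (repr z)) (valP (repr h)).
- exact: valP (repr h).
- move=> t x i j t0; rewrite mxE [X in _ + X]mxE mulrDl.
  by rewrite (le_trans (ler_normB _ _))// lerD// diff_quotient_le.
- move=> x i j; rewrite (_ : (fun t => _) = fun t =>
    diff_quotient t (z x) (h x) i j - derivative (z x) (h x) i j); last first.
    by apply/funext => t; rewrite mxE [X in _ + X]mxE.
  exact/subr_cvg0/derivativeP.
Qed.

End nemytskii.

Theorem theorem2p1 (R : realType) (N : nat) (hN : N = 2%N \/ N = 3%N)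
    (Omega : set 'rV[R]_N) (hOmega : bounded_lipschitz_domain Omega)
    (g : R) (hg : 0 < g)
    (G : L2 Omega -> L2 Omega) (hG : is_nemytskii (soft_threshold g) G) :
  directionally_differentiable G.
Proof.
have g0 := ltW hg.
apply: (nemytskii_directionally_differentiable (soft_threshold g)
  (1 + (N * N)%:R)) hG => [f fS|E F i j|E H i j].
- exact: square_integrable_soft_threshold.
- exact: soft_threshold_lipschitz.
- exact: soft_threshold_derivable.
Qed.
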